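(* For every $\varepsilon\in(0,1)$ and $q\in\mathbb{N}$, there exists an integer $t_3=t_3(q,\varepsilon)$ such that for every integer $t\ge t_3$ and all $k_1,k_2,\dots,k_q\in\mathbb{N}$ satisfying $\sum_{j=1}^q k_j\le (2-\varepsilon)t$, there exists a $K_t$-minor-free graph $G$ that is not $\{k_1,k_2,\dots,k_q\}$-choosable.
   Context: $\mathbb{N}$ denotes the positive integers. All graphs are finite and simple. A graph is $K_t$-minor-free if $K_t$ cannot be obtained from a subgraph of it by contracting edges. A list assignment $L$ of a graph $G$ assigns to each vertex $v$ a set $L(v)$ of colours; an $L$-colouring is a proper colouring $f$ with $f(v)\in L(v)$ for all $v$. For a multiset $\lambda=\{k_1,\dots,k_q\}$ of positive integers, a $\lambda$-list assignment of $G$ is a list assignment $L$ such that the colour set $\bigcup_{v\in V(G)}L(v)$ can be partitioned into $q$ sets $C_1,\dots,C_q$ with $|L(v)\cap C_i|\ge k_i$ for every $i$ and every vertex $v$. $G$ is $\lambda$-choosable if $G$ is $L$-colourable for every $\lambda$-list assignment $L$. *)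

(* Defs.v *)
From HB Require Import structures.
From mathcomp Require Import all_boot all_order all_algebra.
From mathcomp Require Import reals.
Set Implicit Arguments. Unset Strict Implicit. Unset Printing Implicit Defensive.

Definition simple_graph (T : finType) (e : rel T) : Prop :=
  symmetric e /\ irreflexive e.

Definition induced_connected (T : finType) (e : rel T) (S : {set T}) : Prop :=
  forall x y, x \in S -> y \in S ->
    connect [rel u v | [&& e u v, u \in S & v \in S]] x y.

Definition has_K_minor (T : finType) (e : rel T) (t : nat) : Prop :=
  exists B : 'I_t -> {set T},
    [/\ forall i, B i != set0,
        forall i, induced_connected e (B i),
        forall i j, i != j -> [disjoint B i & B j]
      & forall i j, i != j ->
          exists x y, [/\ x \in B i, y \in B j & e x y]].

Definition K_minor_free (T : finType) (e : rel T) (t : nat) : Prop :=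
  ~ has_K_minor e t.

Definition L_colourable (T : finType) (e : rel T) (L : T -> seq nat) : Prop :=
  exists f : T -> nat,
    (forall v, f v \in L v) /\ (forall x y, e x y -> f x != f y).

(* lambda = {k_0, ..., k_(q-1)} given by k : 'I_q -> nat.  L is a
   lambda-list assignment if there is a partition of the colours into
   classes C_0..C_(q-1) (cls c = index of the class of colour c) with
   |L(v) ∩ C_i| >= k_i for all v and i. *)
Definition lambda_list_assignment (T : finType) (q : nat) (k : 'I_q -> nat)
    (L : T -> seq nat) : Prop :=
  exists cls : nat -> 'I_q,
    forall v i, k i <= size (undup [seq c <- L v | cls c == i]).

Definition lambda_choosable (T : finType) (e : rel T) (q : nat)
    (k : 'I_q -> nat) : Prop :=
  forall L : T -> seq nat, lambda_list_assignment k L -> L_colourable e L.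

(* Main.v *)
Require Import Defs.
From HB Require Import structures.
From mathcomp Require Import all_boot all_order all_algebra.
From mathcomp Require Import reals.
From mathcomp Require Import zify lra.
Set Implicit Arguments. Unset Strict Implicit. Unset Printing Implicit Defensive.
Import Order.TTheory GRing.Theory Num.Theory.

(**
Fix a large [d] and put [n = d * s]. The probabilistic method gives a set [N]
of pairs between two [n]-sets [A] and [B] such that every [b] is paired with at
most [s] elements of [A], and yet [N] contains a rectangle [setX X Y] with [X]
in [P] and [Y] in [Q] whenever [P] and [Q] consist of [3 * s] disjoint nonempty
subsets of [A] and of [B]. Indeed, colour [A * B] at random with [d ^ 2]
colours. Among [2 * s] disjoint subsets, [s] have at most [d] elements, so [P]
and [Q] yield [s ^ 2] disjoint rectangles of bounded size; none of them is
monochromatic with probability exp(- c * s ^ 2), against exp(O(s * log s))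
choices of [P] and [Q]. Take for [N] a rare colour, without the columns of more
than [s] elements.

Let the graph consist of a clique on [A] and, for every colouring [c] of [A], a
copy of a clique on [B], with [a] adjacent to every copy of [b] unless [(a, b)]
is in [N]. If it has a [K_t]-minor with [t >= n + 3 * s], the branch sets
missing [A] are adjacent and so lie in a single copy of [B]; there are [3 * s]
of them, and [3 * s] branch sets miss that copy. This contradicts the choice of
[N]. On the other hand, take a palette of fewer than [2 * n] colours, and
remove [c a] for all [(a, b)] in [N] from the list of [b] in copy [c]. In a
list colouring extending [c], all [2 * n] vertices of [A] and copy [c] would
get distinct colours. Each list loses at most [s] colours, so it suffices that
the palette has [k i + s] colours in class [i].
*)

Lemma leq_expn_ffact n m : (n.+1 - m) ^ m <= n ^_ m.
Proof.
elim: m n => [|m IHm] [|n] //; rewrite ?subSS ?sub0n ?exp0n //.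
by rewrite ffactSS expnS leq_mul ?leq_subr.
Qed.

Lemma leq_bin_expn_succ n m w : 'C(n, m) * w ^ (n - m) <= w.+1 ^ n.
Proof.
have [lt_nm|le_mn] := ltnP n m; first by rewrite bin_small.
rewrite -(addn1 w) expnDn (bigD1 (Ordinal (le_mn : m < n.+1))) //=.
by rewrite exp1n muln1 leq_addr.
Qed.

Lemma leq_expn_double_bin n m : m.*2 <= n -> n ^ m <= 2 ^ m * m`! * 'C(n, m).
Proof.
move=> le_2m_n; rewrite -mulnA (mulnC m`!) bin_ffact.
apply: (@leq_trans ((2 * (n.+1 - m)) ^ m)).
  by case: m le_2m_n => // m le_2m_n; rewrite leq_exp2r //; lia.
by rewrite expnMn leq_mul2l leq_expn_ffact orbT.
Qed.

(* The binomial term of [w.+1 ^ s] of index [e.+1] has degree [e.+1] in [s]. *)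
Lemma poly_expn_lt_expn_succ C e w :
  exists s0, forall s, s0 <= s -> C * s ^ e * w ^ s < w.+1 ^ s.
Proof.
pose m := e.+1; pose K := C * (2 ^ m * m`!) * w ^ m.
exists (K + m.*2).+1 => s le_s.
have s_gt0 : 0 < s := leq_trans (ltn0Sn _) le_s.
have le_ms : m <= s by lia.
have poly_le : s ^ m <= 2 ^ m * m`! * 'C(s, m).
  by apply: leq_expn_double_bin; lia.
rewrite -(ltn_pmul2r s_gt0) [ltnRHS]mulnC.
apply: (@leq_ltn_trans (K * w.+1 ^ s)); last first.
  by rewrite ltn_pmul2r ?expn_gt0 //; lia.
have -> : C * s ^ e * w ^ s * s = C * s ^ m * w ^ m * w ^ (s - m).
  by rewrite mulnAC -[C * _ * s]mulnA -expnSr -[RHS]mulnA -expnD subnKC.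
apply: (@leq_trans (C * (2 ^ m * m`! * 'C(s, m)) * w ^ m * w ^ (s - m))).
  by rewrite !leq_mul.
rewrite mulnA (mulnAC _ _ (w ^ m)) -mulnA.
by rewrite leq_mul2l leq_bin_expn_succ orbT.
Qed.

Lemma union_bound (I T : finType) (F : {set I}) (bad : I -> {set T}) m b :
    {in F, forall i, #|bad i| * m <= b} -> #|F| * b < #|T| * m ->
  exists x, {in F, forall i, x \notin bad i}.
Proof.
move=> bad_le lt_b.
have card_bad : #|\bigcup_(i in F) bad i| * m <= #|F| * b.
  rewrite -[leqRHS]sum_nat_const; elim/big_rec2: _ => [|i c B iF IH].
    by rewrite cards0.
  apply: leq_trans (leq_add (bad_le i iF) IH).
  by rewrite -mulnDl leq_mul2r leq_card_setU orbT.
have : ~~ ([set: T] \subset \bigcup_(i in F) bad i).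
  apply: contraL (leq_ltn_trans card_bad lt_b) => /subset_leq_card.
  by rewrite cardsT -leqNgt leq_mul2r orbC => ->.
case/subsetPn => x _ xNbad; exists x => i iF.
by apply: contra xNbad => x_bad; apply/bigcupP; exists i.
Qed.

Lemma sum_card_fibres (T C : finType) (f : T -> C) :
  \sum_c #|f @^-1: [set c]| = #|T|.
Proof.
rewrite -sum1_card (partition_big f predT) //=; apply: eq_bigr => c _.
by rewrite -sum1dep_card; apply: eq_bigl => x; rewrite !inE.
Qed.

Lemma exists_small_fibre (T C : finType) (f : T -> C) m :
  #|T| < #|C| * m.+1 -> exists c, #|f @^-1: [set c]| <= m.
Proof.
move=> lt_T; apply/existsP; apply: contraLR lt_T.
rewrite negb_exists -leqNgt -(sum_card_fibres f) -sum_nat_const => /forallP big.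
by apply: leq_sum => c _; rewrite ltnNge.
Qed.

Lemma card_small_subsets (T : finType) (A : {set T}) d :
  #|[set X : {set T} | (X \subset A) && (0 < #|X| <= d)]| <= #|A| ^ d.
Proof.
pose F := [set f : {ffun 'I_d -> T} in ffun_on (mem A)].
have cardF : #|F| = #|A| ^ d by rewrite cardsE card_ffun_on card_ord.
pose range (f : {ffun 'I_d -> T}) : {set T} := [set f i | i : 'I_d].
rewrite -cardF; apply: leq_trans (leq_imset_card range _).
apply/subset_leq_card/subsetP => X.
rewrite inE => /and3P[sXA /card_gt0P[x0 Xx0] leX].
pose f := [ffun i : 'I_d => nth x0 (enum X) i].
have fX i : f i \in X.
  rewrite ffunE; have [lt_i|ge_i] := ltnP i (size (enum X)).
    by rewrite -mem_enum mem_nth.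
  by rewrite nth_default.
apply/imsetP; exists f.
  by rewrite inE; apply/ffun_onP => i; apply: (subsetP sXA).
apply/setP/subset_eqP/andP; split; last by apply/subsetP => _ /imsetP[i _ ->].
apply/subsetP => x; rewrite -mem_enum => Xx; apply/imsetP.
have lt_x : index x (enum X) < d.
  by apply: leq_trans leX; rewrite cardE index_mem.
by exists (Ordinal lt_x); rewrite // ffunE nth_index.
Qed.

Section Packings.

Variable T : finType.
Implicit Types (X H : {set T}) (P Q : {set {set T}}).

Lemma sum_cardI_trivIset P H :
  trivIset P -> \sum_(X in P) #|X :&: H| = #|cover P :&: H|.
Proof.
move=> trivP; rewrite -sum1dep_card big_trivIset_cond //.
by apply: eq_bigr => X _; rewrite sum1dep_card.
Qed.

Definition missing P H : {set {set T}} := [set X in P | [disjoint X & H]].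

Lemma missing_sub P H : missing P H \subset P.
Proof. by apply/subsetP => X; rewrite inE => /andP[]. Qed.

Lemma leq_card_missing P H m :
  trivIset P -> #|H| + m <= #|P| -> m <= #|missing P H|.
Proof.
move=> trivP le_P; rewrite -(leq_add2l #|H|); apply: leq_trans le_P _.
rewrite -(cardsID [set X : {set T} | [disjoint X & H]] P) -setIdE addnC.
rewrite leq_add2r; apply: leq_trans (subset_leq_card (subsetIr (cover P) H)).
rewrite -sum_cardI_trivIset // -sum1_card.
rewrite [leqRHS](big_setID [set X : {set T} | [disjoint X & H]]).
apply: leq_trans (leq_addl _ _); apply: leq_sum => X.
by rewrite !inE card_gt0 setI_eq0 => /andP[].
Qed.

Lemma leq_card_trivIset_small P d s :
  trivIset P -> #|T| <= d * s -> #|P| <= #|[set X in P | #|X| <= d]| + s.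
Proof.
move=> trivP card_T; rewrite -(cardsID [set X : {set T} | #|X| <= d] P) setIdE.
rewrite leq_add2l; set large := P :\: _.
have : #|large| * d.+1 <= d * s.
  have /eqP card_cover : trivIset large by apply: trivIsetD.
  apply: leq_trans (leq_trans (max_card [in cover large]) card_T).
  rewrite -card_cover -sum_nat_const; apply: leq_sum => X.
  by rewrite !inE -ltnNge => /andP[].
move=> le_large; rewrite -(leq_pmul2r (ltn0Sn d)) (leq_trans le_large) //.
by rewrite mulnC leq_mul2l leqnSn orbT.
Qed.

Definition packing P : bool := trivIset P && (set0 \notin P).

Lemma packingS P Q : P \subset Q -> packing Q -> packing P.
Proof.
move=> sPQ /andP[trivQ Q0]; rewrite /packing (trivIsetS sPQ trivQ).
by apply: contra Q0; apply: subsetP.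
Qed.

Lemma packing_neq0 P X : packing P -> X \in P -> X != set0.
Proof. by case/andP=> _ P0 XP; apply: contraNneq P0 => <-. Qed.

Definition small_packings (d s : nat) : {set {set {set T}}} :=
  [set P | [&& packing P, #|P| == s & [forall X in P, #|X| <= d]]].

Lemma card_small_packings d s :
  0 < s -> #|small_packings d s| <= (#|T| ^ d) ^ s.
Proof.
move=> s_gt0.
pose small := [set X : {set T} | (X \subset setT) && (0 < #|X| <= d)].
have card_small : #|small| <= #|T| ^ d by rewrite -cardsT card_small_subsets.
apply: (@leq_trans (#|small| ^ s)); last by rewrite leq_exp2r.
apply: leq_trans (card_small_subsets small s).
apply/subset_leq_card/subsetP => P; rewrite !inE.
case/and3P=> packP /eqP cardP /forall_inP leP.
rewrite cardP s_gt0 leqnn !andbT; apply/subsetP => X XP.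
by rewrite inE subsetT card_gt0 (packing_neq0 packP) ?leP.
Qed.

Lemma exists_small_packing P d s :
    #|T| <= d * s -> packing P -> 2 * s <= #|P| ->
  exists2 P', P' \in small_packings d s & P' \subset P.
Proof.
move=> card_T packP card_P; have /andP[trivP _] := packP.
have /card_geqP[r [uniq_r size_r sub_r]] : s <= #|[set X in P | #|X| <= d]|.
  by have := leq_card_trivIset_small trivP card_T; lia.
have sub_P : [set X in r] \subset P.
  by apply/subsetP => X; rewrite inE => /sub_r; rewrite inE => /andP[].
exists [set X in r] => //; rewrite inE (packingS sub_P packP).
rewrite cardsE (card_uniqP uniq_r) size_r eqxx.
by apply/forall_inP => X; rewrite inE => /sub_r; rewrite inE => /andP[].
Qed.

End Packings.

Lemma packing_imset (I T : finType) (F : I -> {set T}) (J : {set I}) :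
    {in J, forall i, F i != set0} ->
    {in J &, forall i j, i != j -> [disjoint F i & F j]} ->
  packing (F @: J) /\ #|F @: J| = #|J|.
Proof.
move=> F_neq0 disF.
have FJ0 : set0 \notin F @: J.
  by apply/imsetP => -[i iJ F0]; have /eqP[] := F_neq0 i iJ.
have [|trivF injF] := @trivIimset _ _ [in J] F _ FJ0.
  by move=> i j iJ jJ; rewrite eq_sym; apply: disF.
by rewrite /packing trivF FJ0 card_in_imset.
Qed.

Definition traces (S T : finType) (f : S -> T) (P : {set {set T}}) :
  {set {set S}} := [set f @^-1: (X : {set T}) | X in P].

Lemma packing_traces (S T : finType) (f : S -> T) (P : {set {set T}}) :
    packing P -> {in P, forall X : {set T}, f @^-1: X != set0} ->
  packing (traces f P) /\ #|traces f P| = #|P|.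
Proof.
case/andP=> /trivIsetP disP _ trace_neq0.
apply: packing_imset => // X Y XP YP neqXY; rewrite -setI_eq0 -preimsetI.
by rewrite (disjoint_setI0 (disP X Y XP YP neqXY)) preimset0.
Qed.

Definition rectangles (A B : finType)
    (P : {set {set A}}) (Q : {set {set B}}) :
  {set {set A * B}} := [set setX p.1 p.2 | p in setX P Q].

Lemma packing_rectangles (A B : finType)
    (P : {set {set A}}) (Q : {set {set B}}) :
    packing P -> packing Q ->
  packing (rectangles P Q) /\ #|rectangles P Q| = #|P| * #|Q|.
Proof.
move=> packP packQ; rewrite -cardsX; apply: packing_imset => [[X Y]|].
  case/setXP=> XP YQ; rewrite -card_gt0 cardsX muln_gt0 !card_gt0.
  by rewrite (packing_neq0 packP) ?(packing_neq0 packQ).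
move=> [X Y] [X' Y'] /setXP[/= XP YQ] /setXP[/= X'P Y'Q].
rewrite -setI_eq0; apply: contraNT => /set0Pn[[a b]]; rewrite !inE /=.
case/andP=> /andP[aX bY] /andP[aX' bY'].
have [/andP[trivP _] /andP[trivQ _]] := (packP, packQ).
rewrite -(def_pblock trivP XP aX) -(def_pblock trivP X'P aX').
by rewrite -(def_pblock trivQ YQ bY) -(def_pblock trivQ Y'Q bY').
Qed.

Section BlockAvoidance.

Variables U C : finType.
Implicit Types (Z : {set U}) (P : {set {set U}}) (h : C) (g : {ffun U -> C}).

Definition overwrite Z h g : {ffun U -> C} :=
  [ffun z => if z \in Z then h else g z].

Lemma leq_card_overwrite (G : {set {ffun U -> C}}) Z h :
  #|G| <= #|overwrite Z h @: G| * #|C| ^ #|Z|.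
Proof.
pose F := [set f : {ffun U -> C} in pffun_on h (mem Z) predT].
have cardF : #|F| = #|C| ^ #|Z| by rewrite cardsE card_pffun_on.
pose split_at g := (overwrite Z h g, overwrite (~: Z) h g).
rewrite -cardF -cardsX -(@card_in_imset _ _ split_at) => [|g g' _ _].
  apply/subset_leq_card/subsetP => _ /imsetP[g gG ->].
  rewrite in_setX imset_f //= inE; apply/pffun_onP; split=> //.
  by apply/supportP => z zZ; rewrite ffunE inE zZ.
case=> /ffunP eq_out /ffunP eq_in; apply/ffunP => z.
by have := eq_out z; have := eq_in z; rewrite !ffunE inE; case: (z \in Z).
Qed.

Definition avoiding h P : {set {ffun U -> C}} :=
  [set g : {ffun U -> C} | [forall Z in P, ~~ (Z \subset g @^-1: [set h])]].

(* Given that no other block is entirely of colour [h], the block [Z] is so with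
   probability at least [1 / #|C| ^ w]: [overwrite Z h] affects no other block. *)
Lemma card_avoidingD1 P Z h w :
    trivIset P -> Z \in P -> #|Z| <= w ->
  #|avoiding h P| * #|C| ^ w <= (#|C| ^ w).-1 * #|avoiding h (P :\ Z)|.
Proof.
move=> /trivIsetP disP ZP card_Z.
pose mono := [set g : {ffun U -> C} | Z \subset g @^-1: [set h]].
have eq_avoiding : avoiding h P = avoiding h (P :\ Z) :\: mono.
  apply/setP => g; rewrite !inE.
  apply/forall_inP/andP => [gP|[gZ /forall_inP gP] Y YP].
    by split; [exact: gP|apply/forall_inP => Y /setD1P[_ /gP]].
  by have [->//|neqYZ] := eqVneq Y Z; rewrite gP // !inE neqYZ.
have overwrite_sub :
    overwrite Z h @: avoiding h (P :\ Z) \subset avoiding h (P :\ Z) :&: mono.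
  apply/subsetP => _ /imsetP[g + ->]; rewrite !inE => /forall_inP gP.
  apply/andP; split; last by apply/subsetP => z zZ; rewrite !inE ffunE zZ.
  apply/forall_inP => Y PY; apply: contra (gP Y PY) => /subsetP monoY.
  have [neqYZ YP] := setD1P PY.
  apply/subsetP => y yY; have := monoY y yY.
  by rewrite !inE ffunE (disjointFr (disP Y Z YP ZP neqYZ) yY).
have C_gt0 : 0 < #|C| by apply/card_gt0P; exists h.
have leq_mono :
    #|avoiding h (P :\ Z)| <= #|avoiding h (P :\ Z) :&: mono| * #|C| ^ w.
  apply: leq_trans (leq_card_overwrite _ Z h) _.
  by rewrite leq_mul ?subset_leq_card // leq_pexp2l.
have Cw_gt0 : 0 < #|C| ^ w by rewrite expn_gt0 C_gt0.
rewrite eq_avoiding -subn1 mulnBl mul1n leq_subRL ?leq_pmull //.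
by rewrite -[in leqRHS](cardsID mono) mulnDr ![_ ^ w * _]mulnC leq_add2r.
Qed.

Lemma card_avoiding P h w :
    trivIset P -> {in P, forall Z, #|Z| <= w} ->
  #|avoiding h P| * (#|C| ^ w) ^ #|P| <= (#|C| ^ w).-1 ^ #|P| * #|C| ^ #|U|.
Proof.
move card_P: #|P| => n; elim: n P card_P => [|n IHn] P card_P trivP leP.
  by rewrite muln1 mul1n -card_ffun max_card.
have /card_gt0P[Z ZP] : 0 < #|P| by rewrite card_P.
have card_PZ : #|P :\ Z| = n by move: card_P; rewrite (cardsD1 Z) ZP => -[].
have lePZ : {in P :\ Z, forall Y : {set U}, #|Y| <= w}.
  by move=> Y /setD1P[_ /leP].
have {}IHn := IHn _ card_PZ (trivIsetD _ trivP) lePZ.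
rewrite !expnS mulnA.
apply: leq_trans (leq_mul (card_avoidingD1 h trivP ZP (leP Z ZP)) (leqnn _)) _.
by rewrite -!mulnA leq_mul2l IHn orbT.
Qed.

End BlockAvoidance.

Section RectangleRich.

Variables A B : finType.
Implicit Types N : {set A * B}.

Definition rectangle_rich (m : nat) N : Prop :=
  forall (P : {set {set A}}) (Q : {set {set B}}),
    packing P -> packing Q -> m <= #|P| -> m <= #|Q| ->
  exists X Y, [/\ X \in P, Y \in Q & setX X Y \subset N].

Lemma rectangle_rich_gt0 m N : rectangle_rich m N -> 0 < m.
Proof.
have packing0 T : packing (set0 : {set {set T}}).
  by rewrite /packing inE andbT; apply/trivIsetP => X; rewrite inE.
case: m => // /(_ set0 set0 (packing0 A) (packing0 B)).
by case=> // X [Y []]; rewrite inE.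
Qed.

Lemma exists_rich_colouring (C : finType) d s :
    let w := #|C| ^ (d * d) in
    0 < #|C| -> 0 < s -> #|A| <= d * s -> #|B| <= d * s ->
    #|C| * (#|A| ^ d) ^ s * (#|B| ^ d) ^ s * w.-1 ^ (s * s) < w ^ (s * s) ->
  exists g : {ffun A * B -> C},
    forall h, rectangle_rich (2 * s) (g @^-1: [set h]).
Proof.
move=> w C_gt0 s_gt0 card_A card_B few_choices.
pose choices :=
  setX [set: C] (setX (small_packings A d s) (small_packings B d s)).
pose bad (c : C * ({set {set A}} * {set {set B}})) :=
  avoiding c.1 (rectangles c.2.1 c.2.2).
have card_bad :
    {in choices, forall c,
      #|bad c| * w ^ (s * s) <= w.-1 ^ (s * s) * #|C| ^ #|{: A * B}|}.
  move=> [h [P Q]]; rewrite !inE /=.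
  case/andP=> /and3P[packP /eqP card_P /forall_inP leP].
  case/and3P=> packQ /eqP card_Q /forall_inP leQ.
  have [/andP[trivPQ _] card_PQ] := packing_rectangles packP packQ.
  rewrite card_P card_Q in card_PQ; rewrite -card_PQ.
  apply: card_avoiding => // Z.
  by case/imsetP=> -[X Y] /setXP[XP YQ] ->; rewrite cardsX leq_mul ?leP ?leQ.
have [|g g_good] := union_bound card_bad.
  rewrite card_ffun mulnA mulnC ltn_pmul2l ?expn_gt0 ?C_gt0 //.
  apply: leq_ltn_trans few_choices; rewrite leq_mul2r !cardsX cardsT -mulnA.
  by rewrite !leq_mul ?card_small_packings ?orbT.
exists g => h P Q packP packQ leP leQ.
have [P' smallP' subP'] := exists_small_packing card_A packP leP.
have [Q' smallQ' subQ'] := exists_small_packing card_B packQ leQ.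
have : g \notin bad (h, (P', Q')).
  by apply: g_good; rewrite !in_setX inE smallP'.
rewrite inE => /forall_inPn[_ /imsetP[[X Y] /setXP[XP' YQ'] ->]].
rewrite negbK => mono.
by exists X, Y; rewrite (subsetP subP') ?(subsetP subQ').
Qed.

Definition column N (b : B) : {set A} := [set a | (a, b) \in N].

Lemma sum_card_column N : \sum_b #|column N b| = #|N|.
Proof.
under eq_bigr do rewrite -sum1dep_card big_mkcond.
rewrite exchange_big pair_big /= -sum1_card [RHS]big_mkcond /=.
by apply: eq_bigr => -[a b].
Qed.

Lemma card_heavy_columns N s : #|[set b | s < #|column N b|]| * s.+1 <= #|N|.
Proof.
rewrite -sum_nat_const -sum_card_column.
rewrite [leqRHS](bigID [in [set b | s < #|column N b|]]) /=.
by apply: leq_trans (leq_addr _ _); apply: leq_sum => b; rewrite inE.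
Qed.

Lemma rectangle_rich_sparsify N m s :
    #|N| <= s * s -> rectangle_rich m N ->
  exists N', (forall b, #|column N' b| <= s) /\ rectangle_rich (m + s) N'.
Proof.
move=> card_N richN; pose heavy := [set b | s < #|column N b|].
have card_heavy : #|heavy| <= s.
  by have := card_heavy_columns N s; rewrite -/heavy; nia.
exists [set p in N | p.2 \notin heavy]; split=> [b|P Q packP packQ leP leQ].
  have [heavy_b|] := boolP (b \in heavy).
    by rewrite eq_card0 // => a; rewrite inE /= inE heavy_b andbF.
  rewrite inE -leqNgt; apply: leq_trans; apply/subset_leq_card/subsetP => a.
  by rewrite !inE => /andP[].
have /andP[trivQ _] := packQ.
have card_light : m <= #|missing Q heavy|.
  apply: leq_card_missing trivQ (leq_trans _ leQ).
  by rewrite addnC leq_add2l.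
have leP_m : m <= #|P| := leq_trans (leq_addr s m) leP.
have pack_light := packingS (missing_sub Q heavy) packQ.
have [X [Y [XP]]] := richN P _ packP pack_light leP_m card_light.
rewrite inE => /andP[YQ lightY] subN; exists X, Y; split=> //.
apply/subsetP => -[a b] abXY; have /setXP[_ bY] := abXY.
by rewrite inE (subsetP subN) //= (disjointFr lightY bY).
Qed.

End RectangleRich.

Lemma exists_sparse_rectangle_rich d :
  0 < d -> exists s0, forall s, s0 <= s ->
    exists N : {set 'I_(d * s) * 'I_(d * s)},
      (forall b, #|column N b| <= s) /\ rectangle_rich (3 * s) N.
Proof.
move=> d_gt0; pose D := d * d; pose w := D ^ (d * d).
have D_gt0 : 0 < D by rewrite muln_gt0 d_gt0.
have w_gt0 : 0 < w by rewrite expn_gt0 D_gt0.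
have [s0 decay] := poly_expn_lt_expn_succ (D * d ^ (2 * d)) (2 * d) w.-1.
exists s0.+1 => s lt_s; have s_gt0 : 0 < s := leq_trans (ltn0Sn s0) lt_s.
have card_choices :
    D * ((d * s) ^ d) ^ s * ((d * s) ^ d) ^ s
      <= (D * d ^ (2 * d) * s ^ (2 * d)) ^ s.
  rewrite -[leqLHS]mulnA -expnMn -expnD addnn -mul2n.
  rewrite -[D * d ^ _ * _]mulnA -[d ^ _ * _]expnMn [leqRHS]expnMn.
  by rewrite leq_mul2r -{1}(expn1 D) leq_pexp2l ?orbT.
have [||||g richg] :=
    @exists_rich_colouring 'I_(d * s) 'I_(d * s) 'I_D d s _ s_gt0;
  rewrite ?card_ord // -/w.
  apply: leq_ltn_trans (leq_mul card_choices (leqnn _)) _.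
  rewrite !(expnM _ s) -expnMn ltn_exp2r //.
  by have := decay s (ltnW lt_s); rewrite (prednK w_gt0).
have [|h card_h] := @exists_small_fibre _ _ g (s * s).
  by rewrite card_prod !card_ord; nia.
have [N [sparseN richN]] := rectangle_rich_sparsify card_h (richg h).
by exists N; split=> //; rewrite (_ : 3 * s = 2 * s + s) //; lia.
Qed.

Definition joined (T : finType) (e : rel T) (X Y : {set T}) : Prop :=
  exists x y, [/\ x \in X, y \in Y & e x y].

Definition clique_model (T : finType) (e : rel T) (P : {set {set T}}) : Prop :=
  [/\ packing P, {in P, forall X, induced_connected e X}
    & {in P &, forall X Y, X != Y -> joined e X Y}].

Lemma has_K_minor_clique_model (T : finType) (e : rel T) t :
  has_K_minor e t -> exists2 P, clique_model e P & #|P| = t.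
Proof.
case=> S [S_neq0 connS disS adjS].
have [|i j _ _|packS cardS] := @packing_imset _ _ S setT; first by move=> i _.
  exact: disS.
exists (S @: setT); last by rewrite cardS cardsT card_ord.
split=> //; first by move=> _ /imsetP[i _ ->].
move=> _ _ /imsetP[i _ ->] /imsetP[j _ ->] neqS; apply: adjS.
by apply: contraNneq neqS => ->.
Qed.

Section GluedGraph.

Variables (A B C : finType) (N : {set A * B}).

(* [N] is the set of NON-edges between [A] and each copy of [B]. *)
Definition glued_edge : rel (A + C * B) := fun v w =>
  match v, w with
  | inl a, inl a' => a != a'
  | inl a, inr (_, b) | inr (_, b), inl a => (a, b) \notin N
  | inr (c, b), inr (c', b') => (c == c') && (b != b')
  end.

Lemma glued_edge_simple : simple_graph glued_edge.
Proof.
split=> [[a|[c b]] [a'|[c' b']] | [a|[c b]]] //=; rewrite ?eqxx ?andbF //.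
- by rewrite eq_sym.
- by rewrite (eq_sym c) (eq_sym b).
Qed.

Definition core : {set A + C * B} := [set inl a | a in setT].

Definition copy (c : C) : {set A + C * B} := [set inr (c, b) | b in setT].

Lemma card_core : #|core| = #|A|.
Proof. by rewrite card_imset ?cardsT // => a a' []. Qed.

Lemma card_copy c : #|copy c| = #|B|.
Proof. by rewrite card_imset ?cardsT // => b b' []. Qed.

Lemma notin_core v : v \notin core -> exists c, v \in copy c.
Proof.
case: v => [a /imsetP[]|[c b] _]; first by exists a.
by exists c; apply: imset_f.
Qed.

Lemma glued_edge_copy c v w :
  v \in copy c -> w \notin core -> glued_edge v w -> w \in copy c.
Proof.
case/imsetP=> b _ -> /notin_core[c' /imsetP[b' _ ->]] /= /andP[/eqP-> _].
exact: imset_f.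
Qed.

Lemma connected_sub_copy (X : {set A + C * B}) c v :
    induced_connected glued_edge X -> [disjoint X & core] ->
    v \in X -> v \in copy c ->
  X \subset copy c.
Proof.
move=> connX coreX vX v_copy; apply/subsetP => w wX.
have /connectP[p path_p ->] := connX v w vX wX.
elim: p v v_copy path_p {vX} => //= u p IHp v v_copy /andP[/and3P[vu _ uX]].
apply: IHp; apply: (glued_edge_copy v_copy _ vu).
by rewrite (disjointFr coreX uX).
Qed.

Lemma core_free_sub_copy (P : {set {set A + C * B}}) :
    clique_model glued_edge P -> #|A| < #|P| ->
  exists c, {in P, forall X : {set _}, [disjoint X & core] -> X \subset copy c}.
Proof.
move=> [packP connP joinP] card_P; have /andP[trivP _] := packP.
have /card_gt0P[X0] : 0 < #|missing P core|.
  by apply: leq_card_missing; rewrite // card_core addn1.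
rewrite inE => /andP[X0P coreX0].
have /set0Pn[v vX0] := packing_neq0 packP X0P.
have [c v_copy] := notin_core (negbT (disjointFr coreX0 vX0)).
have X0_copy := connected_sub_copy (connP X0 X0P) coreX0 vX0 v_copy.
exists c => X XP coreX; have [->//|neqX] := eqVneq X X0.
have [|x [y [xX0 yX xy]]] := joinP X0 X X0P XP; first by rewrite eq_sym.
apply: (connected_sub_copy (connP X XP) coreX yX).
apply: (glued_edge_copy (subsetP X0_copy x xX0) _ xy).
by rewrite (disjointFr coreX yX).
Qed.

Lemma joined_copy (X Y : {set A + C * B}) c :
    joined glued_edge X Y -> [disjoint X & copy c] -> Y \subset copy c ->
  exists a b, [/\ inl a \in X, inr (c, b) \in Y & (a, b) \notin N].
Proof.
case=> [[a|[c' b']] [y [xX yY xy]]] copyX /subsetP/(_ y yY)/imsetP[b _ def_y].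
  by exists a, b; rewrite -def_y; split=> //; move: xy; rewrite def_y.
move: xy; rewrite def_y => /andP[/eqP def_c' _].
by have := disjointFr copyX xX; rewrite def_c' imset_f.
Qed.

Lemma core_trace_neq0 (X : {set A + C * B}) :
  ~~ [disjoint X & core] -> inl @^-1: X != set0.
Proof.
rewrite -setI_eq0 => /set0Pn[v /setIP[vX /imsetP[a _ def_v]]].
by apply/set0Pn; exists a; rewrite inE -def_v.
Qed.

Lemma copy_trace_neq0 (X : {set A + C * B}) c :
  ~~ [disjoint X & copy c] -> (fun b => inr (c, b)) @^-1: X != set0.
Proof.
rewrite -setI_eq0 => /set0Pn[v /setIP[vX /imsetP[b _ def_v]]].
by apply/set0Pn; exists b; rewrite inE -def_v.
Qed.

Lemma glued_K_minor_free m t :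
    #|A| + m <= t -> #|B| + m <= t -> rectangle_rich m N ->
  K_minor_free glued_edge t.
Proof.
move=> leA leB richN /has_K_minor_clique_model[P modelP card_P].
have m_gt0 := rectangle_rich_gt0 richN.
have [|c coreP] := core_free_sub_copy modelP; first by rewrite card_P; lia.
have [packP _ joinP] := modelP; have /andP[trivP _] := packP.
have meets_copy X : X \in P -> [disjoint X & core] -> ~~ [disjoint X & copy c].
  move=> XP /(coreP X XP)/setIidPl eqX.
  by rewrite -setI_eq0 eqX (packing_neq0 packP XP).
have traceX : {in missing P (copy c), forall X : {set _}, inl @^-1: X != set0}.
  move=> X /setIdP[XP copyX]; apply: core_trace_neq0.
  by apply: contraL copyX => /(meets_copy X XP).
have traceY : {in missing P core, forall Y : {set _},
    (fun b => inr (c, b)) @^-1: Y != set0}.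
  by move=> Y /setIdP[YP /(meets_copy Y YP)/copy_trace_neq0].
have [packX cardX] := packing_traces (packingS (missing_sub P _) packP) traceX.
have [packY cardY] := packing_traces (packingS (missing_sub P _) packP) traceY.
have [||X' [Y' [/imsetP[X XP' ->] /imsetP[Y YP' ->] /subsetP subN]]] :=
    richN _ _ packX packY.
- by rewrite cardX leq_card_missing // card_copy card_P.
- by rewrite cardY leq_card_missing // card_core card_P.
have [/setIdP[XP copyX] /setIdP[YP coreY]] := (XP', YP').
have neqXY : X != Y by apply: contraTneq copyX => ->; apply: meets_copy.
have [a [b [aX bY]]] :=
  joined_copy (joinP X Y XP YP neqXY) copyX (coreP Y YP coreY).
by rewrite subN // in_setX !inE aX.
Qed.

End GluedGraph.

Lemma lambda_choosable_finType (T P : finType) (e : rel T) q (k : 'I_q -> nat)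
    (cls : P -> 'I_q) (L : T -> {set P}) :
    0 < q -> lambda_choosable e k ->
    (forall v i, k i <= #|L v :&: cls @^-1: [set i]|) ->
  exists f : T -> P,
    (forall v, f v \in L v) /\ (forall v w, e v w -> f v != f w).
Proof.
move=> q_gt0 choose leL.
have [|f [fL f_proper]] := choose (fun v => [seq pickle x | x <- enum (L v)]).
  exists (fun n => oapp cls (Ordinal q_gt0) (unpickle n)) => v i.
  apply: leq_trans (leL v i) _; rewrite filter_map undup_id; last first.
    by rewrite (map_inj_uniq (pcan_inj pickleK)) filter_uniq ?enum_uniq.
  rewrite size_map cardE uniq_leq_size ?enum_uniq // => x.
  by rewrite mem_enum mem_filter mem_enum !inE /= pickleK andbC.
have f_pickle v : exists2 x, x \in L v & f v = pickle x.
  by have /mapP[x xL ->] := fL v; exists x => //; rewrite -mem_enum.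
have [h hL fE] := fin_all_exists2 f_pickle; exists h; split=> // v w /f_proper.
by rewrite !fE; apply: contraNneq => ->.
Qed.

Lemma card_tag_fibre (I : finType) (F : I -> finType) i :
  #|@tag I F @^-1: [set i]| = #|F i|.
Proof.
rewrite (bij_eq_card (@tag_with_bij I F i)) card_sig.
by apply: eq_card => x; rewrite !inE.
Qed.

Section GluedColouring.

Variables (A B : finType) (N : {set A * B}).

Lemma glued_colouring_card (C P : finType) (f : A + C * B -> P) c :
    (forall v w, glued_edge N v w -> f v != f w) ->
    (forall a b, (a, b) \in N -> f (inl a) != f (inr (c, b))) ->
  #|A| + #|B| <= #|P|.
Proof.
move=> f_proper f_N.
have neqAB a b : f (inl a) != f (inr (c, b)).
  by have [/f_N|Nab] := boolP ((a, b) \in N); last exact: f_proper.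
pose F (v : A + B) := f (match v with inl a => inl a | inr b => inr (c, b) end).
rewrite -card_sum; apply: (@leq_card _ _ F) => v w /eqP; apply: contraTeq.
case: v w => [a|b] [a'|b'] neq_vw; rewrite /F //.
- exact: f_proper.
- by rewrite eq_sym.
- by apply: f_proper; rewrite /= eqxx.
Qed.

Variables (q : nat) (k : 'I_q -> nat) (s : nat).

Let palette : finType := {i : 'I_q & 'I_(k i + s)}.

Lemma card_palette : #|palette| = \sum_i k i + q * s.
Proof.
rewrite card_tagged sumnE big_map big_enum /=.
under eq_bigr do rewrite card_ord.
by rewrite big_split /= sum_nat_const card_ord.
Qed.

Definition forbidden (v : A + {ffun A -> palette} * B) : {set palette} :=
  if v is inr (c, b) then c @: column N b else set0.

Lemma glued_not_choosable :
    0 < q -> (forall b, #|column N b| <= s) ->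
    \sum_i k i + q * s < #|A| + #|B| ->
  ~ lambda_choosable (glued_edge (C := {ffun A -> palette}) N) k.
Proof.
move=> q_gt0 sparseN small choose.
have card_forbidden v : #|forbidden v| <= s.
  case: v => [a|[c b]] /=; first by rewrite cards0.
  exact: leq_trans (leq_imset_card _ _) (sparseN b).
have [v i|f [fL f_proper]] :=
    @lambda_choosable_finType _ palette _ _ _ tag (fun v => ~: forbidden v)
      q_gt0 choose.
  rewrite setIC -setDE cardsD card_tag_fibre card_ord.
  have card_lost : #|tag @^-1: [set i] :&: forbidden v| <= s.
    exact: leq_trans (subset_leq_card (subsetIr _ _)) (card_forbidden v).
  by rewrite -[leqLHS](addnK s) leq_sub2l.
pose c := [ffun a => f (inl a)].
have le_AB : #|A| + #|B| <= #|palette|.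
  apply: (glued_colouring_card (c := c) f_proper) => a b Nab.
  have := fL (inr (c, b)); rewrite inE; apply: contraNneq => <-.
  by apply/imsetP; exists a; rewrite ?inE ?ffunE.
by have := leq_trans small le_AB; rewrite card_palette ltnn.
Qed.

End GluedColouring.

Local Open Scope ring_scope.

Lemma exists_natmul_ge (R : archiNumFieldType) (eps x : R) :
  0 < eps -> 0 <= x -> exists2 n, (0 < n)%N & x <= eps * n%:R.
Proof.
move=> eps_gt0 x_ge0; exists (Num.bound (x / eps)).+1 => //.
rewrite mulrC -ler_pdivrMr //.
apply: le_trans (ltW (archi_boundP _)) _; last by rewrite ler_nat.
by rewrite divr_ge0 // ltW.
Qed.

(* In [8 = 6 + 2], the [6] pays for [2 * 3 * s.+1] and the [2] for the rounding
   term [2 * d <= 2 * s]. *)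
Lemma palette_size_lt (R : realFieldType) (eps : R) (q d s t K : nat) :
    0 < eps < 1 -> q%:R + 8 <= eps * d%:R ->
    (d <= s)%N -> (t <= (d + 3) * s.+1)%N -> K%:R <= (2 - eps) * t%:R ->
  (K + q * s < d * s + d * s)%N.
Proof.
move=> /andP[eps_gt0 eps_lt1] le_d; rewrite -(ltr_nat R) -!(ler_nat R).
rewrite !natrM [(d + 3)%:R]natrD -[s.+1%:R]natr1 !(natrD _ _ (_ * _)) !natrM.
move=> le_ds le_t le_K.
have s_ge0 : 0 <= s%:R :> R by [].
have q_ge0 : 0 <= q%:R :> R by [].
have coef_le : (2 - eps) * (d%:R + 3) <= 2 * d%:R - q%:R - 2 by nra.
have K_le : K%:R <= (2 - eps) * (d%:R + 3) * (s%:R + 1).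
  by apply: (le_trans le_K); rewrite -mulrA ler_wpM2l //; lra.
have : K%:R <= (2 * d%:R - q%:R - 2) * (s%:R + 1) :> R.
  by apply: (le_trans K_le); rewrite ler_wpM2r //; lra.
nra.
Qed.

Theorem theorem4 (R : realType) (eps : R) (q : nat) :
  0 < eps < 1 -> (0 < q)%N ->
  exists t3 : nat, forall t : nat, (t3 <= t)%N ->
    forall k : 'I_q -> nat, (forall i, (0 < k i)%N) ->
      ((\sum_(i < q) k i)%N%:R <= (2 - eps) * t%:R) ->
      exists (T : finType) (e : rel T),
        [/\ simple_graph e, K_minor_free e t & ~ lambda_choosable e k].
Proof.
move=> eps01 q_gt0; have /andP[eps_gt0 _] := eps01.
have [d d_gt0 le_d] : exists2 d, (0 < d)%N & q%:R + 8 <= eps * d%:R.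
  by apply: exists_natmul_ge => //; rewrite addr_ge0.
have [s0 sparse_rich] := exists_sparse_rectangle_rich d_gt0.
exists ((d + 3) * (s0 + d))%N => t le_t k _ le_k.
pose s := (t %/ (d + 3))%N.
have le_s : (s0 + d <= s)%N by rewrite leq_divRL 1?mulnC // addn3.
have [N [sparseN richN]] := sparse_rich s (leq_trans (leq_addr d s0) le_s).
exists _, (glued_edge (C := {ffun 'I_(d * s) -> {i : 'I_q & 'I_(k i + s)}}) N).
split; first exact: glued_edge_simple.
  have le_t_st : ((d + 3) * s <= t)%N by rewrite mulnC leq_divM.
  by apply: glued_K_minor_free richN; rewrite card_ord -mulnDl.
apply: glued_not_choosable => //; rewrite card_ord.
apply: palette_size_lt eps01 le_d (leq_trans (leq_addl s0 d) le_s) _ le_k.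
by rewrite mulnC ltnW // -ltn_divLR // addn3.
Qed.
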